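(* Let $L$ be a lattice of rank $d$, let $P\subset L\otimes_{\mathbb{Z}}\mathbb{R}$ be a rational polytope of full dimension, and let $\mathcal{T}$ be a complete, rational simplicial fan in $L^\vee\otimes_{\mathbb{Z}}\mathbb{R}$ that refines the normal fan $\mathcal{N}(P)$. Then $$K_P(y_0;\mathbf{z})=\sum_{C\in\mathcal{T}}(-1)^{\operatorname{codim}(C)}K_{P,C}(y_0;\mathbf{z})=\sum_{C\in\mathcal{T}}K^\circ_{P,C}(y_0;\mathbf{z}).$$ In particular, $K_P(y_0;\mathbf{y})$ is a rational function in $y_0$ and in the variables $\mathbf{y}=\exp_{y_0}(\mathbf{z})=(y_1=y_0^{z_1},\ldots,y_d=y_0^{z_d})$.
   Context: Identify $L\cong\mathbb{Z}^d$ and the dual lattice $L^\vee=\mathrm{Hom}_{\mathbb{Z}}(L,\mathbb{Z})\cong\mathbb{Z}^d$ by dual bases; $\mathbf{z}=(z_1,\ldots,z_d)\in L\otimes\mathbb{R}$, and $\mathbf{v}(\mathbf{x})$ denotes the pairing. A polytope is rational if its vertices lie in $L\otimes\mathbb{Q}$. For a face $F$ of $P$, the dual cone is $C_F=\{\mathbf{v}\in L^\vee\otimes\mathbb{R} : \min_{\mathbf{x}\in P}\mathbf{v}(\mathbf{x})=\mathbf{v}(\mathbf{p})\ \forall \mathbf{p}\in F\}$, and the normal fan $\mathcal{N}(P)$ is the collection of all $C_F$. The notation $\exp_t(A)$ means $t^A$. The dual lattice function of the full-dimensional polytope $P$ is $$K_P(y_0;\mathbf{z})=\sum_{\mathbf{v}\in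 L^\vee}y_0^{\min_{\mathbf{x}\in P}\mathbf{v}(\mathbf{x}-\mathbf{z})};$$ it is written $K_P(y_0;\mathbf{y})$ when expressed in the variables $\mathbf{y}$. For a rational simplicial cone $C$ contained in some $C_F$, $$K_{P,C}(y_0;\mathbf{z})=\sum_{\mathbf{v}\in C\cap L^\vee}y_0^{\min_{\mathbf{x}\in P}\mathbf{v}(\mathbf{x}-\mathbf{z})},\qquad K^\circ_{P,C}(y_0;\mathbf{z})=\sum_{\mathbf{v}\in \mathrm{Int}(C)\cap L^\vee}y_0^{\min_{\mathbf{x}\in P}\mathbf{v}(\mathbf{x}-\mathbf{z})},$$ where $\mathrm{Int}(C)$ is the relative interior. For real $y_0>1$ all these series converge for $\mathbf{z}$ in the interior of $P$, and they are identified with the functions they sum to. The sums over $\mathcal{T}$ run over all cones of all dimensions (including $\{0\}$), and the codimension of $C$ is $d-\dim C$.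
   Formalization: ''Rational function in y_0 and y'' is false for rational non-lattice P (e.g. [-1/2,1/2]); it is proved as a rational function in y_0^{1/N} and y for every N>0 with NP a lattice polytope (such N exists; N=1 gives the literal claim for lattice polytopes). *)

(* Defs.v *)
From HB Require Import structures.
From mathcomp Require Import all_boot all_order all_algebra.
From mathcomp Require Import all_classical all_reals all_analysis.
(* Not imported: the notations of mpoly clash with those of analysis. *)
From mathcomp Require mpoly.

Set Implicit Arguments.
Unset Strict Implicit.
Unset Printing Implicit Defensive.

Import Order.TTheory GRing.Theory Num.Theory.
Import numFieldNormedType.Exports.

Local Open Scope classical_set_scope.
Local Open Scope ring_scope.

(* L and its dual are both identified with Z^d by dual bases, so that L (x) R
   and its dual are both 'rV[R]_d; by convention v, u are dual vectors and
   x, z, p are vectors of L (x) R. *)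
Definition pairing (R : realType) d (v x : 'rV[R]_d) : R :=
  \sum_i v 0 i * x 0 i.

Definition lattice (R : realType) d : set 'rV[R]_d :=
  range (fun u : 'rV[int]_d => map_mx (fun a : int => a%:~R) u).

Definition rational_points (R : realType) d : set 'rV[R]_d :=
  range (fun u : 'rV[rat]_d => map_mx ratr u).

Definition affine_hull (R : realType) d (A : set 'rV[R]_d) : set 'rV[R]_d :=
  [set x | exists n (a : 'I_n -> R) (p : 'I_n -> 'rV[R]_d),
    [/\ forall i, A (p i), \sum_i a i = 1 & x = \sum_i a i *: p i]].

Definition convex_hull (R : realType) d (A : set 'rV[R]_d) : set 'rV[R]_d :=
  [set x | exists n (a : 'I_n -> R) (p : 'I_n -> 'rV[R]_d),
    [/\ forall i, A (p i), forall i, 0 <= a i, \sum_i a i = 1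
      & x = \sum_i a i *: p i]].

Definition polytope (R : realType) d (P : set 'rV[R]_d) : Prop :=
  exists2 A : set 'rV[R]_d, finite_set A & P = convex_hull A.

Definition full_dimensional (R : realType) d (P : set 'rV[R]_d) : Prop :=
  affine_hull P = setT.

(* F is the locus where a linear functional v attains its minimum on A.
   For A a cone that minimum is 0, so v lies in the cone dual to A and
   F is the intersection of A with the hyperplane orthogonal to v.  The empty
   set is not a face. *)
Definition face (R : realType) d (A F : set 'rV[R]_d) : Prop :=
  exists v p, [/\ A p, forall x, A x -> pairing v p <= pairing v x
    & F = [set x | A x /\ pairing v x = pairing v p]].

Definition vertex (R : realType) d (P : set 'rV[R]_d) (x : 'rV[R]_d) : Prop :=
  face P [set x].

Definition rational_polytope (R : realType) d (P : set 'rV[R]_d) : Prop :=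
  polytope P /\ forall x, vertex P x -> rational_points x.

(* The infimum is attained when P is a nonempty polytope and f is affine. *)
Definition min_on (R : realType) d (P : set 'rV[R]_d) (f : 'rV[R]_d -> R) : R :=
  inf (f @` P).

Definition dual_cone (R : realType) d (P F : set 'rV[R]_d) : set 'rV[R]_d :=
  [set v | forall p, F p -> min_on P (pairing v) = pairing v p].

Definition normal_fan (R : realType) d (P : set 'rV[R]_d) :
    set (set 'rV[R]_d) :=
  [set C | exists2 F, face P F & C = dual_cone P F].

Definition rational_simplicial_cone (R : realType) d (C : set 'rV[R]_d) : Prop :=
  exists k (M : 'M[R]_(k, d)),
    [/\ row_free M, forall i, rational_points (row i M)
      & C = [set v | exists2 a : 'rV[R]_k, forall i, 0 <= a 0 i & v = a *m M]].

Definition rational_simplicial_fan (R : realType) d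
    (T : set (set 'rV[R]_d)) : Prop :=
  [/\ finite_set T,
      forall C, T C -> rational_simplicial_cone C,
      forall C D, T C -> face C D -> T D
    & forall C D, T C -> T D -> face C (C `&` D) /\ face D (C `&` D)].

Definition complete (R : realType) d (T : set (set 'rV[R]_d)) : Prop :=
  \bigcup_(C in T) C = setT.

Definition refines (R : realType) d (T S : set (set 'rV[R]_d)) : Prop :=
  forall C, T C -> exists2 D, S D & C `<=` D.

(* Dimension of the linear span of C. *)
Definition dim (R : realType) d (C : set 'rV[R]_d) : nat :=
  \max_(k < d.+1 | `[< exists2 M : 'M[R]_(k, d),
                         row_free M & forall i, C (row i M) >]) k.

Definition codim (R : realType) d (C : set 'rV[R]_d) : nat := (d - dim C)%N.

Definition relative_interior (R : realType) d (A : set 'rV[R]_d) :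
    set 'rV[R]_d :=
  [set x | A x /\ within (affine_hull A) (nbhs x) A].

Definition K_term (R : realType) d (P : set 'rV[R]_d) (y0 : R)
    (z v : 'rV[R]_d) : R :=
  y0 `^ min_on P (fun x => pairing v (x - z)).

(* The terms are nonnegative, so the sum always exists in \bar R; [fine] sends
   +oo to 0 and is meaningful only when the terms are summable. *)
Definition K_sum (R : realType) d (P S : set 'rV[R]_d) (y0 : R)
    (z : 'rV[R]_d) : R :=
  fine (\esum_(v in S `&` @lattice R d) (K_term P y0 z v)%:E)%E.

Definition K (R : realType) d (P : set 'rV[R]_d) (y0 : R) (z : 'rV[R]_d) : R :=
  K_sum P setT y0 z.

Definition K_cone (R : realType) d (P C : set 'rV[R]_d) (y0 : R)
    (z : 'rV[R]_d) : R :=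
  K_sum P C y0 z.

Definition K_cone_int (R : realType) d (P C : set 'rV[R]_d) (y0 : R)
    (z : 'rV[R]_d) : R :=
  K_sum P (relative_interior C) y0 z.

Definition exp_ (R : realType) d (t : R) (A : 'rV[R]_d) : 'rV[R]_d :=
  map_mx (fun a => t `^ a) A.

(* N P is a lattice polytope. *)
Definition denominator (R : realType) d (P : set 'rV[R]_d) (N : nat) : Prop :=
  (0 < N)%N /\ forall x, vertex P x -> lattice (N%:R *: x).

(* The point (t, y_1, ..., y_d). *)
Definition point (R : realType) d (t : R) (y : 'rV[R]_d) : 'I_d.+1 -> R :=
  fun i => if unlift ord0 i is Some j then y 0 j else t.

(* For 1 < y0 and z in the interior of P, f y0 z is the value of one fixed
   rational function at (y0^(1/N), y) with y = exp_{y0}(z).  The exponents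
   v(p), p a vertex of P, of y0 in K are integers only when P is a lattice
   polytope; in general they lie in (1/N) Z for N a denominator of P. *)
Definition rational_function (R : realType) d (P : set 'rV[R]_d) (N : nat)
    (f : R -> 'rV[R]_d -> R) : Prop :=
  exists num den : mpoly.mpoly d.+1 R,
    forall y0 z, 1 < y0 -> P° z ->
      let w := point (y0 `^ N%:R^-1) (exp_ y0 z) in
      mpoly.meval w den != 0 /\
      f y0 z = mpoly.meval w num / mpoly.meval w den.

(* Main.v *)
Require Import Defs.
From HB Require Import structures.
From mathcomp Require Import all_boot all_order all_algebra finmap.
From mathcomp Require Import all_classical all_reals all_analysis.
From mathcomp Require mpoly.
From mathcomp Require Import ring lra.

Set Implicit Arguments.
Unset Strict Implicit.
Unset Printing Implicit Defensive.

Import Order.TTheory GRing.Theory Num.Theory.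
Import (canonicals) mpoly.
Import numFieldNormedType.Exports.

Local Open Scope classical_set_scope.
Local Open Scope ring_scope.


(** The lattice series is summed cone by cone, so the first two formulas come
    down to identities between indicator functions of cones of [T]: every [v]
    lies in the relative interior of exactly one cone, the smallest one that
    contains it ([relative_interior_cover]), and the sum of (-1)^codim C over
    the cones [C] containing [v] is 1 ([fan_euler]).  When [z] is interior to
    [P], the exponent min_P v(x - z) is at most -e |v|_1 for some e > 0
    ([interior_min_on]), so the series is dominated by a product of geometric
    series and such identities can be summed against it ([fine_esum_cover]).

    The Euler relation [fan_euler] says that the link of a cone in a complete
    fan has the Euler characteristic of a sphere.  Here it is obtained from a
    generic direction [w], one outside the span of every cone of smaller
    dimension.  From any point [p], the short segment from [p] in the direction
    [w] lies in exactly one cone, which has full dimension ([germ_ex],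
    [germ_inj]).  Starting instead from a relatively interior point of a cone
    [F] in the direction [-w] assigns to [F] a full-dimensional cone S(F), of
    which [F] is a face.  Fix [v] and a full-dimensional cone S containing [v].
    A face of S is given by a set I of generators, and it contains [v] and is
    assigned to S exactly when I contains every generator along which [v] or
    [w] has a positive coordinate ([germ_subcones]).  The alternating sum over
    these I vanishes unless those generators are all of them
    ([sum_sign_supersets]), that is, unless the segment from [v] in the
    direction [w] starts inside S; and this holds for exactly one S.

    For rationality, each cone of [T] lies in a full-dimensional one, on which
    min_P v is given by a single point of [P]: a face on which all these [v]
    are constant is a vertex p ([cone_vertex]).  On such a cone the term is the
    character y0^(v(p) - v(z)), a Laurent monomial in y0^(1/N) and the y_i
    ([rational_character]).  Requiring one coordinate after the other to be
    less than 1 multiplies the sum by 1 - chi(m), m the corresponding generator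
    ([slab_sum_step]), and what is left at the end is a finite sum over the
    fundamental parallelepiped. *)

(** * The pairing and the faces of a simplicial cone *)

Section Pairing.
Variables (R : realType) (d : nat).
Implicit Types u v x y : 'rV[R]_d.

Lemma pairingC v x : pairing v x = pairing x v.
Proof. by apply: eq_bigr => i _; rewrite mulrC. Qed.

Lemma pairing_mx v x : pairing v x = (v *m x^T) 0 0.
Proof. by rewrite mxE; apply: eq_bigr => i _; rewrite mxE. Qed.

Lemma pairingDr v x y : pairing v (x + y) = pairing v x + pairing v y.
Proof. by rewrite -big_split/=; apply: eq_bigr => i _; rewrite mxE mulrDr. Qed.

Lemma pairingZr v c x : pairing v (c *: x) = c * pairing v x.
Proof. by rewrite mulr_sumr; apply: eq_bigr => i _; rewrite mxE mulrCA. Qed.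

Lemma pairingDl u v x : pairing (u + v) x = pairing u x + pairing v x.
Proof. by rewrite !(pairingC _ x) pairingDr. Qed.

Lemma pairing0r v : pairing v 0 = 0.
Proof. by rewrite -(scale0r 0) pairingZr mul0r. Qed.

Lemma pairingBr v x y : pairing v (x - y) = pairing v x - pairing v y.
Proof. by rewrite pairingDr -scaleN1r pairingZr mulN1r. Qed.

Lemma pairing_sumr v (I : finType) (F : I -> 'rV[R]_d) :
  pairing v (\sum_i F i) = \sum_i pairing v (F i).
Proof.
by apply: (big_morph (pairing v)) => [x y|]; rewrite ?pairingDr ?pairing0r.
Qed.

Lemma pairing_mulmx u k (a : 'rV[R]_k) (M : 'M[R]_(k, d)) :
  pairing u (a *m M) = \sum_i a 0 i * pairing u (row i M).
Proof.
rewrite mulmx_sum_row pairing_sumr; apply: eq_bigr => i _.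
by rewrite pairingZr.
Qed.

End Pairing.

Section Cones.
Variables (R : realType) (d : nat).
Implicit Types (F C D : set 'rV[R]_d) (p q v w : 'rV[R]_d).

Definition cone k (M : 'M[R]_(k, d)) : set 'rV[R]_d :=
  [set v | exists2 a : 'rV[R]_k, forall i, 0 <= a 0 i & v = a *m M].

(** Faces are indexed by the generators that they contain, which makes the
    face lattice of a simplicial cone a Boolean lattice. *)
Definition subcone k (M : 'M[R]_(k, d)) (I : {set 'I_k}) : set 'rV[R]_d :=
  [set v | exists2 a : 'rV[R]_k,
     (forall i, 0 <= a 0 i) /\ (forall i, i \notin I -> a 0 i = 0)
  & v = a *m M].

(** A point of the relative interior, described by faces only: this does not
    refer to generators, of which one cone has many choices. *)
Definition core F p :=
  F p /\ forall D, face F D -> D p -> D = F.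

Section Generators.
Variables (k : nat) (M : 'M[R]_(k, d)).
Implicit Types I J : {set 'I_k}.

Lemma cone_conv p q t : 0 <= t <= 1 -> cone M p -> cone M q ->
  cone M ((1 - t) *: p + t *: q).
Proof.
move=> /andP[t0 t1] [a a0 ->] [b b0 ->]; exists ((1 - t) *: a + t *: b).
  by move=> i; rewrite !mxE addr_ge0// mulr_ge0// subr_ge0.
by rewrite mulmxDl !scalemxAl.
Qed.

Lemma cone_row i : cone M (row i M).
Proof.
by exists (delta_mx 0 i) => [j|]; rewrite -?rowE// mxE !eqxx/= ler0n.
Qed.

Lemma cone0 : cone M 0.
Proof. by exists 0 => [i|]; rewrite ?mxE// mul0mx. Qed.

Lemma subcone_sub I : subcone M I `<=` cone M.
Proof. by move=> _ [a [a0 _] ->]; exists a. Qed.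

Lemma subconeT : subcone M finset.setT = cone M.
Proof.
apply/seteqP; split; first exact: subcone_sub.
by move=> _ [a a0 ->]; exists a => //; split=> // i; rewrite finset.in_setT.
Qed.

(** A linear form bounded below on a cone is nonnegative on its generators, so
    it vanishes at a nonnegative combination only if every generator that is
    used is orthogonal to it. *)
Lemma face_cone_subcone F : face (cone M) F -> exists I, F = subcone M I.
Proof.
move=> [u [p [Cp minp ->]]].
(* Dilating [p] would otherwise decrease the minimum. *)
have up0 : pairing u p = 0.
  apply/eqP; rewrite eq_le -{1}(pairing0r u) (minp _ cone0)/=.
  have : pairing u p <= pairing u (2 *: p).
    apply: minp; case: Cp => a a0 ->; exists (2 *: a).
      by move=> i; rewrite mxE mulr_ge0.
    by rewrite scalemxAl.
  by rewrite pairingZr mulr_natl mulr2n lerDl.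
have u0 i : 0 <= pairing u (row i M) by rewrite -up0; exact/minp/cone_row.
exists [set i | pairing u (row i M) == 0]%SET; apply/seteqP; split=> x /=.
  move=> [[a a0 ->]]; rewrite up0 pairing_mulmx => /eqP.
  rewrite psumr_eq0 => [/allP/= au|i _]; last by rewrite mulr_ge0.
  exists a => //; split=> // i; rewrite inE => ui.
  have /eqP := au i (mem_index_enum i).
  by move=> /eqP; rewrite mulf_eq0 (negbTE ui) orbF => /eqP.
move=> [a [a0 aI] ->]; split; first by exists a.
rewrite up0 pairing_mulmx big1// => i _.
have [/eqP ->|ui] := boolP (pairing u (row i M) == 0); first by rewrite mulr0.
by rewrite aI ?mul0r// inE.
Qed.

Hypothesis freeM : row_free M.

Lemma coordK (a : 'rV[R]_k) : a *m M *m pinvmx M = a.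
Proof. by rewrite -mulmxA mulmxVp// mulmx1. Qed.

(** The generators are free, so some linear form takes the value 0 on those in
    [I] and 1 on the others. *)
Lemma face_subcone I : face (cone M) (subcone M I).
Proof.
pose e : 'cV[R]_k := \col_i (i \notin I)%:R.
pose u : 'rV[R]_d := (pinvmx M *m e)^T.
have uM (a : 'rV[R]_k) : pairing u (a *m M) = \sum_i a 0 i * (i \notin I)%:R.
  rewrite pairingC pairing_mx trmxK mulmxA coordK mxE.
  by apply: eq_bigr => i _; rewrite mxE.
exists u, 0; split; first exact: cone0.
  move=> _ [a a0 ->]; rewrite pairing0r uM sumr_ge0// => i _.
  by rewrite mulr_ge0.
apply/seteqP; split=> x /=.
  move=> [a [a0 aI] ->]; split; first by exists a.
  rewrite uM pairing0r big1// => i _.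
  by have [_|/aI ->] := boolP (i \in I); rewrite ?mulr0 ?mul0r.
move=> [[a a0 ->]]; rewrite uM pairing0r => /eqP.
rewrite psumr_eq0 => [/allP/= au|i _]; last by rewrite mulr_ge0.
exists a => //; split=> // i iI.
by have := au i (mem_index_enum i); rewrite iI mulr1 => /eqP.
Qed.

Lemma subcone_row I i : subcone M I (row i M) <-> i \in I.
Proof.
split=> [[a [_ aI]] ai|iI].
  apply: contraT => /aI; rewrite -[a]coordK -ai rowE coordK.
  by move/eqP; rewrite mxE !eqxx oner_eq0.
exists (delta_mx 0 i); last by rewrite -rowE.
split=> j; rewrite mxE eqxx/= ?ler0n//; case: (eqVneq j i) => // ->.
by rewrite iI.
Qed.

Lemma subcone_inj : injective (subcone M).
Proof.
move=> I J IJ; apply/setP => i; apply/idP/idP=> /subcone_row.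
  by rewrite IJ => /subcone_row.
by rewrite -IJ => /subcone_row.
Qed.

Lemma core_cone p :
  core (cone M) p <-> exists2 a : 'rV[R]_k, forall i, 0 < a 0 i & p = a *m M.
Proof.
split=> [[[a a0 ap] corep]|[a a0 ->]].
  exists a => // i; rewrite lt_neqAle a0 andbT; apply/eqP => ai.
  have := corep _ (face_subcone (~: [set i])%SET).
  rewrite -subconeT => /(_ _)/subcone_inj/setP/(_ i); rewrite !inE eqxx.
  have H : subcone M (~: [set i])%SET p.
    by exists a => //; split=> // j; rewrite !inE negbK => /eqP ->.
  by move=> /(_ H).
split=> [|D /face_cone_subcone[I ->]]; first by exists a => // i; exact: ltW.
move=> [b [_ bI]] /(congr1 (mulmxr (pinvmx M)))/=; rewrite !coordK => ab.
rewrite -subconeT; congr subcone; apply/setP => i; rewrite finset.in_setT.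
by apply: contraT => /bI /eqP; rewrite -ab gt_eqF.
Qed.

(** Independent vectors of [C] that span [C] are a family of maximal size. *)
Lemma dim_eq C : (forall i, C (row i M)) -> (forall x, C x -> (x <= M)%MS) ->
  Defs.dim C = k.
Proof.
move=> CM Csub; have kd : (k < d.+1)%N.
  by rewrite ltnS -(eqP freeM) rank_leq_col.
apply/anti_leq/andP; split.
  apply/bigmax_leqP => -[l ld]/= /asboolP[N freeN CN].
  rewrite -(eqP freeN) -(eqP freeM); apply: mxrankS; apply/row_subP => i.
  exact/Csub/CN.
by apply: (bigop.bigmax_sup (Ordinal kd)) => //; apply/asboolP; exists M.
Qed.

Lemma dim_cone : Defs.dim (cone M) = k.
Proof.
apply: dim_eq => [i|_ [a _ ->]]; first exact: cone_row.
exact: submxMl.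
Qed.

End Generators.

Lemma dim_subcone k (M : 'M[R]_(k, d)) (I : {set 'I_k}) : row_free M ->
  Defs.dim (subcone M I) = #|I|.
Proof.
move=> freeM; pose E : 'M[R]_(#|I|, k) := rowsub (@enum_val _ (mem I)) 1%:M.
have EE : E *m E^T = 1%:M.
  apply/matrixP => i j; rewrite mul_rowsub_mx mul1mx !mxE.
  by rewrite (inj_eq enum_val_inj) eq_sym.
have EM i : row i (E *m M) = row (enum_val i) M.
  by rewrite mul_rowsub_mx mul1mx row_rowsub.
apply: (@dim_eq _ (E *m M)).
- rewrite /row_free eqn_leq rank_leq_row mxrankMfree//=.
  by have := mxrankM_maxl E E^T; rewrite EE mxrank1.
- by move=> i; rewrite EM; apply/subcone_row => //; exact: enum_valP.
- move=> _ [a [_ aI] ->].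
  rewrite mulmx_sum_row (bigID [in I])/= [X in _ + X]big1 ?addr0; last first.
    by move=> i /aI ->; rewrite scale0r.
  apply: summx_sub => i iI; apply: scalemx_sub.
  by rewrite -(enum_rankK_in iI iI) -EM row_sub.
Qed.

End Cones.


(** * Germs of segments in a complete fan *)

(** A nonzero form restricted to the moment curve (1, t, t^2, ...) is a nonzero
    polynomial in t, and so is the product of finitely many of them: any t
    which is not one of its roots gives a suitable vector. *)
Lemma avoid_hyperplanes (R : realType) (d : nat) (us : seq 'rV[R]_d) :
  (forall u, u \in us -> u != 0) ->
  exists w, forall u, u \in us -> pairing u w != 0.
Proof.
move=> us0; pose p := \prod_(u <- us) rVpoly u.
have p0 : p != 0.
  rewrite /p prodf_seq_neq0; apply/allP => u /us0 /=.
  apply: contraNN => /eqP u0.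
  by rewrite -(rVpolyK u) u0 linear0.
have [t pt] : exists t : R, p.[t] != 0.
  apply: contrapT => /forallNP pt.
  have := @max_poly_roots _ p [seq n%:R | n <- iota 0 (size p)] p0.
  rewrite size_map size_iota ltnn => H; suff: false by [].
  apply: H.
    by apply/allP => _ /mapP[n _ ->]; apply/negPn/negP; exact: pt.
  by rewrite (map_inj_uniq (@mulrIn R 1 (oner_neq0 R))) iota_uniq.
exists (\row_i t ^+ i) => u uus.
have := pt; rewrite horner_prod prodf_seq_neq0 => /allP/(_ u uus)/=.
rewrite (@horner_coef_wide _ d); last exact: size_poly.
under eq_bigr do rewrite coef_rVpoly_ord.
by under [pairing _ _]eq_bigr do rewrite mxE.
Qed.

Section Germs.
Variables (R : realType) (d : nat).
Implicit Types (F C D : set 'rV[R]_d) (p q v w : 'rV[R]_d).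

(** [C] contains a short initial segment, its starting point [v] excepted, of
    the ray from [v] in the direction [w]. *)
Definition germ C v w := \forall e \near 0^'+, C (v + e *: w).

Lemma near_right0P (P : R -> Prop) : (\forall e \near 0^'+, P e) <->
  exists2 e0, 0 < e0 & forall e, 0 < e < e0 -> P e.
Proof.
split=> [/nbhs_ballP[e0/= e00 H]|[e0 e00 H]].
  exists e0 => // e /andP[e1 e2]; apply: H => //=.
  by rewrite /ball/= sub0r normrN gtr0_norm.
apply/nbhs_ballP; exists e0 => //= e; rewrite /ball/= sub0r normrN => H1 H2.
by apply: H; rewrite H2/= (le_lt_trans _ H1)// ler_norm.
Qed.

(** The parameters at which the ray is in a convex set form an interval, which
    either is adjacent to 0 or stays away from 0. *)
Lemma germ_or k (M : 'M[R]_(k, d)) v w :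
  germ (cone M) v w \/ \forall e \near 0^'+, ~ cone M (v + e *: w).
Proof.
have [|nC] := pselect (\forall e \near 0^'+, ~ cone M (v + e *: w)).
  by right.
have exC e0 : 0 < e0 -> exists2 e, 0 < e < e0 & cone M (v + e *: w).
  move=> e00; apply: contrapT => H; apply: nC; apply/near_right0P.
  exists e0 => // e ee CM.
  by apply: H; exists e.
left; apply/near_right0P; have [e1 /andP[e10 _] Ce1] := exC _ ltr01.
exists e1 => // e /andP[e0 ee1]; have [e2 /andP[e20 ee2] Ce2] := exC _ e0.
have e21 : 0 < e1 - e2 by rewrite subr_gt0 (lt_trans ee2).
pose t := (e - e2) / (e1 - e2).
have t01 : 0 <= t <= 1.
  rewrite divr_ge0 ?subr_ge0 ?(ltW ee2) ?(ltW (lt_trans ee2 ee1))//=.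
  by rewrite ler_pdivrMr// mul1r lerD2r ltW.
have := cone_conv t01 Ce2 Ce1; congr (cone M).
rewrite !scalerDr addrACA -scalerDl subrK scale1r; congr (_ + _).
rewrite !scalerA -scalerDl; congr (_ *: _).
rewrite mulrBl mul1r -addrA -mulrN -mulrDr [- _ + _]addrC /t divfK ?gt_eqF//.
by rewrite addrCA subrr addr0.
Qed.

End Germs.

Section Fans.
Variables (R : realType) (d : nat) (T : set (set 'rV[R]_d)).
Implicit Types (F C D : set 'rV[R]_d) (p q v w : 'rV[R]_d).

Hypothesis fanT : rational_simplicial_fan T.

Let finT : finite_set T. Proof. by case: fanT. Qed.

Lemma in_fanP C : reflect (T C) (C \in fset_set T).
Proof. by rewrite in_fset_set//; apply: (iffP idP); rewrite inE. Qed.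

Lemma fan_cone C : T C -> exists k (M : 'M[R]_(k, d)), row_free M /\ C = cone M.
Proof.
by case: fanT => _ + _ _ TC => /(_ C TC)[k [M [fM _ ->]]]; exists k, M.
Qed.

Lemma fan_subcone k (M : 'M[R]_(k, d)) I : row_free M -> T (cone M) ->
  T (subcone M I).
Proof.
case: fanT => _ _ + _ fM TM; apply; first exact: TM.
exact: face_subcone.
Qed.

(** Asking for a form that separates [w] from the cone avoids the choice of a
    basis of the span. *)
Definition generic w := forall C, T C -> (Defs.dim C < d)%N ->
  exists2 u, pairing u w != 0 & forall x, C x -> pairing u x = 0.

Lemma generic_ex : exists w, generic w.
Proof.
have /choice[U Uprop] : forall C, exists u : 'rV[R]_d,
    T C -> (Defs.dim C < d)%N -> u != 0 /\ forall x, C x -> pairing u x = 0.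
  move=> C; have [[TC dC]|H] := pselect (T C /\ (Defs.dim C < d)%N); last first.
    by exists 0 => TC dC; case: H.
  have [k [M [fM CM]]] := fan_cone TC.
  move: dC; rewrite CM dim_cone// => kd.
  have /rowV0Pn[u /sub_kermxP uM u0] : kermx M^T != 0.
    by rewrite -mxrank_eq0 mxrank_ker mxrank_tr (eqP fM) -lt0n subn_gt0.
  exists u => _ _; split=> // _ [a _ ->].
  by rewrite pairing_mx trmx_mul mulmxA uM mul0mx mxE.
pose us := [seq U C | C <- fset_set T & (Defs.dim C < d)%N].
have [|w wU] := @avoid_hyperplanes _ _ us.
  move=> _ /mapP[C + ->]; rewrite mem_filter => /andP[dC /in_fanP TC].
  by case: (Uprop C TC dC).
exists w => C TC dC; have [_ CU] := Uprop C TC dC; exists (U C) => //.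
by apply: wU; apply/mapP; exists C => //; rewrite mem_filter dC; apply/in_fanP.
Qed.

(** The face [F `&` D] of [F] contains a relatively interior point of [F], so it
    is [F]. *)
Lemma core_sub F D p : T F -> T D -> core F p -> D p -> face D F.
Proof.
case: fanT => _ _ _ TI TF TD [Fp corep] Dp.
have [FI DI] := TI _ _ TF TD.
by rewrite -(corep _ FI).
Qed.

Lemma face_sub C D : face C D -> D `<=` C.
Proof. by move=> [u [p [_ _ ->]]] x []. Qed.

Lemma core_inj C D v : T C -> T D -> core C v -> core D v -> C = D.
Proof.
move=> TC TD coreC coreD; apply/seteqP; split; apply: face_sub.
  by apply: (core_sub TC TD coreC); case: coreD.
by apply: (core_sub TD TC coreD); case: coreC.
Qed.

Lemma core_ex C : T C -> exists p, core C p.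
Proof.
move=> /fan_cone[k [M [fM ->]]].
exists (const_mx 1 *m M); apply/core_cone => //.
by exists (const_mx 1) => // i; rewrite mxE.
Qed.

(** Descent on the dimension: when a coordinate of [v] vanishes, [v] lies in the
    facet opposite to the corresponding generator. *)
Lemma face_core C v : T C -> C v -> exists2 D, T D & core D v.
Proof.
move: {2}(Defs.dim C) (leqnn (Defs.dim C)) => n; elim: n C => [|n IHn] C.
all: move=> + TC; have [k [M [fM CM]]] := fan_cone TC; move: TC; rewrite CM.
all: rewrite dim_cone// => TM kn [a a0 va].
  exists (cone M) => //; apply/core_cone => //; exists a => // i.
  by have := leq_trans (ltn_ord i) kn.
have [ap|/existsNP[i ai]] := pselect (forall i, 0 < a 0 i).
  by exists (cone M) => //; apply/core_cone => //; exists a.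
apply: (IHn (subcone M (~: [set i])%SET)).
- by rewrite dim_subcone// cardsC1 card_ord; case: (k) kn.
- exact: fan_subcone.
- exists a => //; split=> // j; rewrite !inE negbK => /eqP ->.
  by apply/eqP; rewrite eq_le a0 andbT leNgt; apply/negP.
Qed.

Section Generic.
Variable w : 'rV[R]_d.
Hypothesis genw : generic w.

(** Two points of the segment differ by a multiple of [w], so [w] lies in the
    span of [C]. *)
Lemma germ_dim C v : T C -> germ C v w -> Defs.dim C = d.
Proof.
move=> TC /near_right0P[e0 e00 Ce].
apply/eqP; rewrite eqn_leq; apply/andP; split.
  have [k [M [fM ->]]] := fan_cone TC.
  by rewrite dim_cone// -(eqP fM) rank_leq_col.
rewrite leqNgt; apply/negP => dC; have [u uw uC] := genw TC dC.
have [e1 e2] : 0 < e0 / 2 < e0 /\ 0 < e0 / 3 < e0 by lra.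
have := uC _ (Ce _ e1); rewrite -(uC _ (Ce _ e2)) !pairingDr !pairingZr.
move=> /addrI /(mulIf uw); lra.
Qed.

(** The face [C `&` D] contains the segment as well, so it has full dimension,
    and a simplicial cone is its only face of full dimension. *)
Lemma germ_inj C D v : T C -> T D -> germ C v w -> germ D v w -> C = D.
Proof.
move=> TC TD gC gD.
have [FC FD] : face C (C `&` D) /\ face D (C `&` D).
  by case: fanT => _ _ _; apply.
have TI : T (C `&` D) by case: fanT => _ _ + _; apply; first exact: TC.
have gI : germ (C `&` D) v w by rewrite /germ; near=> e; split; near: e.
suff full E : T E -> face E (C `&` D) -> E = C `&` D.
  by rewrite (full _ TC FC) -(full _ TD FD).
move=> TE; have [k [M [fM EM]]] := fan_cone TE.
rewrite EM => /face_cone_subcone[I].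
have := germ_dim TI gI => + IE; rewrite IE dim_subcone// => Id.
rewrite -subconeT; congr subcone; apply/esym/eqP.
rewrite eqEcard finset.subsetT/= cardsT card_ord Id -(eqP fM).
exact: rank_leq_col.
Unshelve. all: by end_near.
Qed.

Hypothesis completeT : complete T.

(** Otherwise each of the finitely many cones would miss the points of the ray
    close to [v], although the cones cover the space. *)
Lemma germ_ex v : exists2 C, T C & germ C v w.
Proof.
apply: contrapT => nC.
have avoid (s : seq (set 'rV[R]_d)) : {subset s <= fset_set T} ->
    \forall e \near 0^'+, forall C, C \in s -> ~ C (v + e *: w).
  elim: s => [|C s IHs] sT; first by near=> e => C.
  have /in_fanP TC : C \in fset_set T by apply: sT; rewrite inE eqxx.
  have {}IHs := IHs (fun D Ds => sT D (mem_behead (s := C :: s) Ds)).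
  have gC : \forall e \near 0^'+, ~ C (v + e *: w).
    have [k [M [fM CM]]] := fan_cone TC; rewrite CM.
    have [gM|//] := germ_or M v w.
    by case: nC; exists C => //; rewrite CM.
  apply: filterS2 IHs gC => e He Ce D.
  by rewrite inE => /predU1P[->//|]; exact: He.
have /near_right0P[e0 e00 He] := avoid _ (fun _ H => H).
have e0e : 0 < e0 / 2 < e0 by lra.
have : [set: 'rV[R]_d] (v + (e0 / 2) *: w) by [].
by rewrite -completeT => -[C TC]; apply: He e0e _ _; exact/in_fanP.
Unshelve. all: by end_near.
Qed.

End Generic.

End Fans.



(** * The Euler relation of a complete simplicial fan *)

(** The product over i of 1 + G i, with G i = 0 on [J] and -1 elsewhere, is this
    sum after expansion: the sets that do not contain [J] contribute 0. *)
Lemma sum_sign_supersets (R : comNzRingType) (I : finType) (J : {set I}) :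
  \sum_(K : {set I} | J \subset K) (-1) ^+ (#|I| - #|K|)
    = (J == finset.setT)%:R :> R.
Proof.
pose G i : R := if i \in J then 0 else -1.
transitivity (\prod_i (1 + G i)); last first.
  case: (eqVneq J finset.setT) => [JT|JT].
    by rewrite big1// => i _; rewrite /G JT finset.in_setT addr0.
  have [i iJ] : exists i, i \notin J.
    apply/existsP; rewrite -negb_forall; apply: contra JT => /forallP JT.
    by apply/eqP/setP => i; rewrite finset.in_setT JT.
  by rewrite (bigD1 i)//= /G (negbTE iJ) subrr mul0r.
rewrite bigA_distr big_mkcond/=; apply: eq_bigr => K _.
case: ifPn => [JK|/subsetPn[i iJ iK]]; last first.
  by rewrite (bigD1 i)//= (negbTE iK) /G iJ mul0r.
rewrite -{1}[K]finset.setCK -cardsCs -prodr_const.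
rewrite [RHS](bigID [in K])/= [X in X * _]big1 => [|i ->//].
rewrite mul1r; apply: eq_big => [i|i]; first by rewrite inE.
rewrite inE => iK; rewrite (negbTE iK) /G ifN//.
by apply: contra iK => /(fintype.subsetP JK).
Qed.

Lemma sum_unique (R : pzSemiRingType) (I : eqType) (s : seq I) (P : pred I)
    (i : I) :
  uniq s -> i \in s -> P i -> (forall j, j \in s -> P j -> j = i) ->
  \sum_(j <- s) (P j)%:R = 1 :> R.
Proof.
move=> us si Pi Puniq; rewrite (bigD1_seq i)//= Pi big_seq_cond big1 ?addr0//.
move=> j /andP[js ji]; case: (boolP (P j)) => // /(Puniq j js) ij.
by rewrite ij eqxx in ji.
Qed.

Section FullCones.
Variables (R : realType) (d : nat) (T : set (set 'rV[R]_d)).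
Implicit Types (F C D : set 'rV[R]_d) (p q v w : 'rV[R]_d).

Hypothesis fanT : rational_simplicial_fan T.

Lemma genericN w : generic T w -> generic T (- w).
Proof.
move=> gw C TC dC; have [u uw uC] := gw C TC dC; exists u => //.
by rewrite -scaleN1r pairingZr mulN1r oppr_eq0.
Qed.

Section FullCone.
Variable M : 'M[R]_d.
Hypotheses (freeM : row_free M) (TM : T (cone M)).
Local Notation a v := (v *m pinvmx M).

Lemma full_coordK v : a v *m M = v.
Proof. by rewrite pinvmxE -?row_free_unit// mulmxKV -?row_free_unit. Qed.

Lemma full_coneP v : cone M v <-> forall i, 0 <= a v 0 i.
Proof.
split=> [[b b0 ->] i|av]; first by rewrite coordK.
by exists (a v) => //; rewrite full_coordK.
Qed.

Lemma full_subconeP I v : subcone M I v <->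
  cone M v /\ forall i, i \notin I -> a v 0 i = 0.
Proof.
split=> [[b [b0 bI] ->]|[Cv aI]].
  by rewrite coordK//; split=> //; exists b.
exists (a v); last by rewrite full_coordK.
by split=> //; apply/full_coneP.
Qed.

(** A vanishing coordinate would put [w] in the span of a facet. *)
Lemma generic_coord_neq0 w i : generic T w -> a w 0 i != 0.
Proof.
move=> genw; apply/eqP => awi.
have [|u /eqP + uM] := genw _ (fan_subcone fanT (~: [set i])%SET freeM TM).
  by rewrite dim_subcone// cardsC1 card_ord; case: (d) i {awi} => [[]|].
apply; rewrite -[w]full_coordK pairing_mulmx big1// => j _.
have [->|ji] := eqVneq j i; first by rewrite awi mul0r.
by rewrite uM ?mulr0//; apply/subcone_row => //; rewrite !inE.
Qed.

(** Coordinates are affine along the ray: each of them has to be positive at [v]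
    or to increase from the value 0. *)
Lemma germ_coordP v w : generic T w -> germ (cone M) v w <->
  forall i, 0 <= a v 0 i /\ (0 < a v 0 i \/ 0 < a w 0 i).
Proof.
move=> genw.
have aE e i : a (v + e *: w) 0 i = a v 0 i + e * a w 0 i.
  by rewrite mulmxDl -scalemxAl !mxE.
split=> [/near_right0P[e0 e00 He] i|H].
  have {}He e : 0 < e < e0 -> 0 <= a v 0 i + e * a w 0 i.
    by move=> /He/full_coneP/(_ i); rewrite aE.
  have av0 : 0 <= a v 0 i.
    rewrite leNgt; apply/negP => av.
    have : 0 < e0 / 2 < e0 by lra.
    have [aw|aw] := lerP (a w 0 i) 0.
      by move=> /[dup]/He + /andP[e2 _]; nra.
    (* At such an [e] the coordinate is at most half its value at [v]. *)
    pose e := Num.min (e0 / 2) (- a v 0 i / a w 0 i / 2).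
    have e1 : e * a w 0 i <= - a v 0 i / 2.
      rewrite (_ : - _ / 2 = - a v 0 i / a w 0 i / 2 * a w 0 i).
        by rewrite ler_pM2r// ge_min lexx orbT.
      by field; rewrite gt_eqF.
    have ee0 : e <= e0 / 2 by rewrite ge_min lexx.
    have e0' : 0 < e by rewrite lt_min !divr_gt0// oppr_gt0.
    clearbody e; have ee : 0 < e < e0 by lra.
    by have := He _ ee; lra.
  split=> //; have [_|] := ltrP 0 (a v 0 i); first by left.
  move=> av; right; have {av av0} av : a v 0 i = 0.
    by apply/eqP; rewrite eq_le av.
  rewrite lt_neqAle eq_sym generic_coord_neq0//=.
  have e2 : 0 < e0 / 2 < e0 by lra.
  by move: (He _ e2); rewrite av add0r pmulr_rge0//; case/andP: e2.
suff {aE} H' : \forall e \near 0^'+, forall i, 0 <= a v 0 i + e * a w 0 i.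
  by apply: filterS H' => e He; apply/full_coneP => i; rewrite aE.
apply: filter_forall => i; apply/near_right0P; have [av avw] := H i.
have [aw|aw] := lerP 0 (a w 0 i).
  exists 1 => // e /andP[e0 _].
  by rewrite addr_ge0// mulr_ge0// ltW.
have {avw} av0 : 0 < a v 0 i by case: avw => //; rewrite ltNge (ltW aw).
exists (- a v 0 i / a w 0 i) => [|e /andP[e0]].
  by rewrite nmulr_lgt0 ?invr_lt0// oppr_lt0.
by rewrite ltr_ndivlMr//; lra.
Qed.

End FullCone.

End FullCones.



Section Euler.
Variables (R : realType) (d : nat) (T : set (set 'rV[R]_d)).
Implicit Types (F C D : set 'rV[R]_d) (p q v w : 'rV[R]_d).

Hypothesis fanT : rational_simplicial_fan T.

(** For a face of [cone M], a relatively interior point has positive coordinates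
    exactly on the generators of the face.  The segment from it in the direction
    [- w] therefore starts inside [cone M] when [w] is negative along every
    other generator, and the face contains [v] when [v] vanishes along those. *)
Lemma germ_subcones (M : 'M[R]_d) (w v : 'rV[R]_d)
    (p : set 'rV[R]_d -> 'rV[R]_d) :
    row_free M -> T (cone M) -> generic T w ->
    (forall F, T F -> core F (p F)) -> cone M v ->
  forall F, (T F /\ F v /\ germ (cone M) (p F) (- w)) <->
    exists2 I, F = subcone M I & forall i,
      (0 < (v *m pinvmx M) 0 i) || (0 < (w *m pinvmx M) 0 i) -> i \in I.
Proof.
move=> fM TM genw corep Cv F.
have aN i : ((- w) *m pinvmx M) 0 i = - (w *m pinvmx M) 0 i.
  by rewrite mulNmx mxE.
split=> [[TF [Fv /(germ_coordP fanT fM TM _ (genericN genw)) gF]]|[I FI vwI]].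
  have Cp : cone M (p F) by apply/full_coneP => // i; case: (gF i).
  have [I FI] := face_cone_subcone (core_sub fanT TF TM (corep _ TF) Cp).
  have [Fp _] := corep _ TF.
  move: Fv Fp gF; rewrite {1}FI => /(full_subconeP fM)[_ vI].
  rewrite {1}FI => /(full_subconeP fM)[_ pI] gF.
  exists I => // i; apply: contraTT => iI; rewrite vI// ltxx/= -leNgt.
  by have [_] := gF i; rewrite pI// ltxx aN oppr_gt0 => -[//|]; exact: ltW.
have TF : T F by rewrite FI; exact: fan_subcone.
have [Fp _] := corep _ TF.
have pI : cone M (p F) /\ forall i, i \notin I -> (p F *m pinvmx M) 0 i = 0.
  by apply/full_subconeP => //; rewrite -FI.
split=> //; split.
  rewrite FI; apply/full_subconeP => //; split=> // i.
  apply: contraNeq => vi; apply: vwI.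
  by rewrite lt_neqAle eq_sym vi/= ((full_coneP fM v).1 Cv i).
apply/(germ_coordP fanT fM TM _ (genericN genw)) => i; split.
  by case: pI => Cp _; exact: (full_coneP fM (p F)).1.
have [iI|iI] := boolP (i \in I); last first.
  right; rewrite aN oppr_gt0 lt_neqAle (generic_coord_neq0 fanT fM TM)//=.
  by rewrite leNgt; apply: contraNN iI => wi; apply: vwI; rewrite wi orbT.
left; rewrite lt_neqAle eq_sym; have [Cp pI0] := pI.
rewrite ((full_coneP fM _).1 Cp i).
rewrite andbT; apply/eqP => pi0.
have TD : T (subcone M (I :\ i)%SET) by exact: fan_subcone.
have Dp : subcone M (I :\ i)%SET (p F).
  apply/full_subconeP => //; split=> // j; rewrite !inE negb_and negbK.
  by case/orP => [/eqP -> //|]; exact: pI0.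
(* The facet of [F] opposite to generator [i] would contain all of [F]. *)
have := face_sub (core_sub fanT TF TD (corep _ TF) Dp); rewrite FI.
move=> /(_ _ ((subcone_row fM I i).2 iI))/(subcone_row fM).
by rewrite !inE eqxx.
Qed.

Hypothesis completeT : complete T.

(** Each cone is counted once, at the full-dimensional cone that contains the
    segment from its chosen relatively interior point in the direction [- w]. *)
Lemma fan_euler v :
  \sum_(C <- fset_set T) (-1) ^+ codim C * (v \in C)%:R = 1 :> R.
Proof.
have [w genw] := generic_ex fanT.
have /choice[p corep] : forall F, exists p, T F -> core F p.
  move=> F; have [/(core_ex fanT)[p Fp]|nTF] := pselect (T F).
    by exists p.
  by exists 0.
pose sel F C := `[< germ C (p F) (- w) >].
transitivity (\sum_(C <- fset_set T) (`[< germ C v w >])%:R : R); last first.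
  have [C TC gC] := germ_ex fanT w completeT v.
  apply: (@sum_unique _ _ _ _ C) => //.
  - exact: fset_uniq.
  - exact/(in_fanP fanT).
  - exact/asboolP.
  move=> D /(in_fanP fanT) TD /asboolP gD.
  exact: (germ_inj fanT genw TD TC gD gC).
transitivity (\sum_(F <- fset_set T) \sum_(C <- fset_set T)
    ((-1) ^+ codim F * ((v \in F) && sel F C)%:R) : R).
  rewrite big_seq [RHS]big_seq; apply: eq_bigr => F /(in_fanP fanT) TF.
  under eq_bigr do rewrite -mulnb natrM mulrA.
  rewrite -mulr_sumr; have [C TC gC] := germ_ex fanT (- w) completeT (p F).
  rewrite (@sum_unique _ _ _ _ C) ?mulr1//.
  - exact: fset_uniq.
  - exact/(in_fanP fanT).
  - exact/asboolP.
  move=> D /(in_fanP fanT) TD /asboolP gD.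
  exact: (germ_inj fanT (genericN genw) TD TC gD gC).
rewrite exchange_big/=; rewrite big_seq [RHS]big_seq.
apply: eq_bigr => C /(in_fanP fanT) TC.
have [dC|dC] := eqVneq (Defs.dim C) d; last first.
  rewrite big1 => [|F _].
    by case: asboolP => // /(germ_dim fanT genw TC) /eqP; rewrite (negbTE dC).
  rewrite /sel; case: asboolP => [|_]; last by rewrite andbF mulr0.
  by move=> /(germ_dim fanT (genericN genw) TC) /eqP; rewrite (negbTE dC).
have [k [M [fM CM]]] := fan_cone fanT TC.
have kd : k = d by rewrite -dC CM dim_cone.
subst k; subst C; clear dC.
pose J := [set i | (0 < (v *m pinvmx M) 0 i) || (0 < (w *m pinvmx M) 0 i)]%SET.
have [Cv|nCv] := pselect (cone M v); last first.
  rewrite big_seq big1 => [|F /(in_fanP fanT) TF].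
    case: asboolP => // /(germ_coordP fanT fM TC _ genw) gv.
    by case: nCv; apply/full_coneP => // i; case: (gv i).
  rewrite /sel; case: (v \in F) / boolP => [|_]; last by rewrite mulr0.
  rewrite inE => Fv; case: asboolP => [|_]; last by rewrite mulr0.
  move=> /(germ_coordP fanT fM TC _ (genericN genw)) gF.
  have Cp : cone M (p F) by apply/full_coneP => // i; case: (gF i).
  by case: nCv; apply: (face_sub (core_sub fanT TF TC (corep _ TF) Cp)).
rewrite (_ : `[< _ >] = (J == finset.setT)); last first.
  apply/asboolP/eqP => [/(germ_coordP fanT fM TC _ genw) gv|JT].
    by apply/setP => i; rewrite !inE; case: (gv i) => _ [->//|->]; rewrite orbT.
  apply/(germ_coordP fanT fM TC _ genw) => i; split.
    exact: (full_coneP fM v).1.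
  by move/setP: JT => /(_ i); rewrite !inE => /orP.
rewrite -sum_sign_supersets card_ord.
transitivity (\sum_(F <- [seq F <- fset_set T | (v \in F) && sel F (cone M)])
    (-1) ^+ codim F : R).
  rewrite big_filter [RHS]big_mkcond/=; apply: eq_bigr => F _.
  by case: ifP; rewrite ?mulr1 ?mulr0.
pose Q : {set {set 'I_d}} := [set K : {set 'I_d} | J \subset K]%SET.
rewrite (perm_big [seq subcone M K | K <- enum Q])/=.
  rewrite big_map big_enum/=; apply: eq_big => [I|I _]; first by rewrite inE.
  by rewrite /codim dim_subcone.
apply: uniq_perm.
- by rewrite filter_uniq// fset_uniq.
- by rewrite map_inj_uniq ?enum_uniq//; exact: subcone_inj.
- move=> F; apply/idP/idP.
    rewrite mem_filter => /andP[/andP[+ /asboolP gF] /(in_fanP fanT) TF].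
    rewrite inE => Fv.
    have [I FI JI] :=
      (germ_subcones fM TC genw corep Cv F).1 (conj TF (conj Fv gF)).
    apply/mapP; exists I => //; rewrite mem_enum inE.
    by apply/fintype.subsetP => i; rewrite inE; exact: JI.
  move=> /mapP[I]; rewrite mem_enum inE => JI FI.
  have [|TF [Fv gF]] := (germ_subcones fM TC genw corep Cv F).2.
    by exists I => // i Ji; apply: (fintype.subsetP JI); rewrite inE.
  rewrite mem_filter; apply/andP; split; last exact/(in_fanP fanT).
  by apply/andP; split; [rewrite inE|exact/asboolP].
Qed.

End Euler.



(** * Relative interiors and full-dimensional cones *)
Section RelInt.
Variables (R : realType) (d : nat).
Implicit Types (F C D : set 'rV[R]_d) (p q v w : 'rV[R]_d).

Lemma mulmx_coord_continuous k (N : 'M[R]_(d, k)) i :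
  continuous (fun v : 'rV[R]_d => (v *m N) 0 i).
Proof.
have -> : (fun v : 'rV[R]_d => (v *m N) 0 i) = (fun v => \sum_j v 0 j * N j i).
  by apply/funext => v; rewrite mxE.
apply: continuous_big => [|j _]; first exact: add_continuous.
move=> v; apply: (@cvgMr_tmp R _ (nbhs v) _ (fun v : 'rV[R]_d => v 0 j)).
exact: (@coord_continuous R 1 d 0 j v).
Qed.

Lemma near_line (x y : 'rV[R]_d) (A : set 'rV[R]_d) :
  (\forall v \near x, A v) -> \forall e \near 0^'+, A (x + e *: y).
Proof.
move=> Ax; have H : (x + e *: y) @[e --> 0^'+] --> x.
  apply: cvg_at_right_filter.
  rewrite -{2}[x]addr0 -(scale0r y); apply: cvgD; first exact: cvg_cst.
  by apply: cvgZr_tmp; exact: cvg_id.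
exact: H.
Qed.

(** Moving back along a generator that a point does not use leaves the cone
    without leaving its affine hull; conversely positivity of the finitely many
    coordinates is an open condition on the span. *)
Lemma relative_interior_cone k (M : 'M[R]_(k, d)) : row_free M ->
  relative_interior (cone M) = core (cone M).
Proof.
move=> fM; apply/seteqP; split=> x.
  move=> [[a a0 xa] nx].
  apply/(core_cone fM); exists a => // i; rewrite lt_neqAle a0 andbT.
  apply/negP => /eqP ai.
  have /near_right0P[e0 e00 He] := near_line (- row i M) nx.
  have e0e : 0 < e0 / 2 < e0 by lra.
  have aff : affine_hull (cone M) (x + (e0 / 2) *: - row i M).
    pose p (j : 'I_3) : 'rV[R]_d := nth 0 [:: x; row i M; 0] j.
    pose c (j : 'I_3) : R := nth 0 [:: 1; - (e0 / 2); e0 / 2] j.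
    exists 3%N, c, p; split.
    - move=> [[|[|[|//]]] ?]; rewrite /p/=.
      + by exists a.
      + exact: cone_row.
      + exact: cone0.
    - by rewrite !big_ord_recl big_ord0 /c/=; lra.
    - rewrite !big_ord_recl big_ord0 /c /p/= scale1r scaler0 !addr0.
      by rewrite scalerN scaleNr.
  have [b b0] := He _ e0e aff.
  rewrite xa rowE -mulNmx scalemxAl -mulmxDl.
  move=> /(congr1 (mulmxr (pinvmx M)))/=; rewrite !coordK// => abE.
  have := b0 i; rewrite -abE !mxE !eqxx/= -ai; lra.
move=> /(core_cone fM)[a a0 xa].
split; first by exists a => // i; exact: ltW.
have near_pos : \forall v \near x, forall i, 0 < (v *m pinvmx M) 0 i.
  apply: (@filter_forall _ _
    (fun i v => 0 < (v *m pinvmx M) 0 i) (nbhs x)) => i.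
  apply: (cvgr_gt _ (@mulmx_coord_continuous _ (pinvmx M) i x)).
  by rewrite xa coordK.
apply: filterS near_pos => v vpos [n [c [p [Cp _ vE]]]].
exists (v *m pinvmx M) => [i|]; first exact: ltW.
rewrite mulmxKpV// vE summx_sub// => j _; rewrite scalemx_sub//.
by have [b _ ->] := Cp j; exact: submxMl.
Qed.

End RelInt.

Section Refinement.
Variables (R : realType) (d : nat) (T : set (set 'rV[R]_d)).
Hypothesis fanT : rational_simplicial_fan T.
Hypothesis completeT : complete T.

(** The full-dimensional cone that contains the segment from a relatively
    interior point of [C] in a generic direction also contains [C]. *)
Lemma in_full_cone C : T C ->
  exists M : 'M[R]_d, [/\ row_free M, T (cone M) & C `<=` cone M].
Proof.
move=> TC; have [w genw] := generic_ex fanT.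
have [p coreC] := core_ex fanT TC.
have [D TD gD] := germ_ex fanT w completeT p.
have := germ_dim fanT genw TD gD; have [k [M [fM DM]]] := fan_cone fanT TD.
rewrite DM dim_cone// => kd; subst k D; exists M; split=> //.
have /(germ_coordP fanT fM TD _ genw) gp := gD.
apply: face_sub; apply: (core_sub fanT TC TD coreC).
by apply/full_coneP => // i; case: (gp i).
Qed.

End Refinement.



(** * Unordered sums *)
Section Sums.
Variables (R : realType) (T : choiceType).
Implicit Types (S L : set T) (f : T -> R).

Lemma esum_pZl S (a : T -> \bar R) (r : R) : 0 <= r ->
  (forall x, 0 <= a x)%E ->
  (\esum_(x in S) (r%:E * a x) = r%:E * \esum_(x in S) a x)%E.
Proof.
rewrite le_eqVlt => /orP[/eqP <-|r0] a0.
  by rewrite mul0e esum1// => x _; rewrite mul0e.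
rewrite /esum -ereal_sup_pZl//; congr ereal_sup.
apply/seteqP; split=> y /=.
  move=> [X fX <-]; exists (\sum_(x \in X) a x)%E; first by exists X.
  by rewrite ge0_mule_fsumr.
move=> [_ [X fX <-] <-]; exists X => //.
by rewrite ge0_mule_fsumr.
Qed.

Lemma esum_sub_fin S L f : (forall x, 0 <= f x) ->
  (\esum_(x in L) (f x)%:E < +oo)%E ->
  (\esum_(x in S `&` L) (f x)%:E)%E \is a fin_num.
Proof.
move=> f0 fL; rewrite ge0_fin_numE; last first.
  by apply: esum_ge0 => *; rewrite lee_fin.
apply: le_lt_trans fL; rewrite esum_mkcondl; apply: le_esum => x _.
by case: ifP => // _; rewrite lee_fin.
Qed.

(** Extended sums only add nonnegative terms, so the negative coefficients are
    moved to the other side before the identity is summed. *)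
Lemma fine_esum_cover (I : choiceType) (s : seq I) (A : I -> set T) (c : I -> R)
    L f : (forall x, 0 <= f x) -> (\esum_(x in L) (f x)%:E < +oo)%E ->
  (forall x, L x -> \sum_(i <- s) c i * (x \in A i)%:R = 1) ->
  fine (\esum_(x in L) (f x)%:E)%E =
    \sum_(i <- s) c i * fine (\esum_(x in A i `&` L) (f x)%:E)%E.
Proof.
move=> f0 fL cover.
pose E i := (\esum_(x in A i `&` L) (f x)%:E)%E.
have finE i : E i \is a fin_num by exact: esum_sub_fin.
have Epart (b : I -> R) : (forall i, 0 <= b i) ->
    (\esum_(x in L) ((\sum_(i <- s) b i * (x \in A i)%:R) * f x)%:E
       = (\sum_(i <- s) b i * fine (E i))%:E)%E.
  move=> b0.
  transitivity (\esum_(x in L)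
      (\sum_(i <- s) (b i * (x \in A i)%:R * f x)%:E))%E.
    by apply: eq_esum => x _; rewrite mulr_suml -sumEFin.
  rewrite esum_sum => [|x i _ _]; last by rewrite lee_fin !mulr_ge0.
  rewrite -sumEFin; apply: eq_bigr => i _.
  rewrite EFinM fineK// /E esum_mkcondl.
  rewrite -esum_pZl// => [|x]; last by case: ifP; rewrite ?lee_fin.
  apply: eq_esum => x _; rewrite -mulrA EFinM; congr (_ * _)%E.
  by case: ifP; rewrite ?mul1r ?mul0r.
pose p i := Num.max (c i) 0; pose n i := Num.max (- c i) 0.
have p0 i : 0 <= p i by rewrite le_max lexx orbT.
have n0 i : 0 <= n i by rewrite le_max lexx orbT.
have cE i : c i = p i - n i.
  rewrite /p /n; case: (lerP (c i) 0) => ci.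
    by rewrite max_l ?oppr_ge0// sub0r opprK.
  by rewrite max_r ?subr0// oppr_le0 ltW.
have fin_L : (\esum_(x in L) (f x)%:E)%E \is a fin_num.
  by rewrite ge0_fin_numE//; apply: esum_ge0 => *; rewrite lee_fin.
have : ((\sum_(i <- s) p i * fine (E i))%:E =
    \esum_(x in L) (f x)%:E + (\sum_(i <- s) n i * fine (E i))%:E)%E.
  rewrite -!Epart// -esumD; first last.
  - move=> x _; rewrite lee_fin mulr_ge0// sumr_ge0// => i _.
    by rewrite mulr_ge0.
  - by move=> x _; rewrite lee_fin.
  apply: eq_esum => x Lx; rewrite -EFinD; congr (_%:E).
  have := cover _ Lx; under eq_bigr do rewrite cE mulrBl.
  rewrite sumrB => /(canRL (subrK _)) H.
  by rewrite H mulrDl mul1r.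
rewrite -{1}(fineK fin_L) -EFinD => -[H].
under eq_bigr do rewrite cE mulrBl.
by rewrite sumrB -/(E _) H addrK.
Qed.

End Sums.

(** An integer vector is determined by the signs and the absolute values of its
    entries, so the sum is at most the expansion of the power of a doubled
    geometric sum. *)
Lemma box_sum_le (R : realType) d (q : R) (s : seq 'rV[int]_d) :
  0 <= q < 1 -> uniq s ->
  \sum_(u <- s) \prod_i q ^+ `|u 0%R i|%N <= (2 / (1 - q)) ^+ d.
Proof.
move=> /andP[q0 q1] us.
pose N := \max_(u <- s) \max_i `|u 0%R i|%N.
have leN u i : u \in s -> (`|u 0%R i| <= N)%N.
  move=> si; apply: leq_trans (leq_bigmax_seq _ si isT).
  exact: (@leq_bigmax _ (fun i => `|u 0%R i|%N)).
pose enc (u : 'rV[int]_d) : {ffun 'I_d -> bool * 'I_N.+1} :=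
  [ffun i => (u 0 i < 0, inord `|u 0%R i|%N)].
pose h (g : {ffun 'I_d -> bool * 'I_N.+1}) := \prod_i q ^+ (g i).2.
have -> : \sum_(u <- s) \prod_i q ^+ `|u 0%R i|%N = \sum_(g <- map enc s) h g.
  rewrite big_map big_seq [RHS]big_seq; apply: eq_bigr => u si.
  by apply: eq_bigr => i _; rewrite ffunE/= inordK// ltnS leN.
have uenc : uniq (map enc s).
  rewrite map_inj_in_uniq// => u v su sv /ffunP uv; apply/rowP => i.
  have := uv i; rewrite !ffunE => -[sg] /(congr1 val)/=.
  rewrite !inordK ?ltnS ?leN// => ab.
  by rewrite [LHS]intEsign [RHS]intEsign sg ab.
apply: (@le_trans _ _ (\sum_g h g)).
  rewrite (big_uniq _ uenc)/= [leLHS]big_mkcond; apply: ler_sum => g _.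
  by case: ifP => // _; apply: prodr_ge0 => i _; exact: exprn_ge0.
rewrite /h -(bigA_distr_bigA (fun _ (bn : bool * 'I_N.+1) => q ^+ bn.2))/=.
rewrite prodr_const card_ord; apply: lerXn2r.
- by rewrite nnegrE sumr_ge0// => bn _; exact: exprn_ge0.
- by rewrite nnegrE divr_ge0// subr_ge0 ltW.
rewrite -(pair_bigA _ (fun (b : bool) (n : 'I_N.+1) => q ^+ n))/=.
rewrite big_bool/= -mulr2n -[leLHS]mulr_natl.
rewrite ler_pM2l// -[leRHS]mul1r ler_pdivlMr ?subr_gt0//.
by rewrite mulrC -opprB mulNr -subrX1 opprB gerBl exprn_ge0.
Qed.

Lemma intr_mx_inj (R : realType) d :
  injective (fun u : 'rV[int]_d => map_mx (fun a : int => a%:~R : R) u).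
Proof.
move=> u v /matrixP uv; apply/matrixP => i j.
by have := uv i j; rewrite !mxE => /intr_inj.
Qed.

Lemma lattice_geometric_lty (R : realType) d (q : R) : 0 <= q < 1 ->
  (\esum_(v in @lattice R d) (q `^ (\sum_i `|v 0 i|))%:E < +oo)%E.
Proof.
move=> q01; rewrite /lattice esum_image; last first.
  by move=> u v _ _; exact: intr_mx_inj.
apply: (@le_lt_trans _ _ ((2 / (1 - q)) ^+ d)%:E); last exact: ltry.
apply: ge_ereal_sup => _ [X [finX _] <-].
rewrite fsbig_finite// sumEFin lee_fin.
apply: le_trans (box_sum_le q01 (fset_uniq (fset_set X))).
apply: ler_sum => u _; rewrite le_eqVlt; apply/orP; left; apply/eqP.
case/andP: q01 => q0 _.
rewrite (_ : \sum_i _ = (\sum_i `|u 0%R i|%N)%N%:R); last first.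
  by rewrite natr_sum; apply: eq_bigr => i _; rewrite mxE -intr_norm natr_absz.
by rewrite powR_mulrn// expr_sum.
Qed.



(** * Polytopes and lattice points *)
Section Polytope.
Variables (R : realType) (d : nat).
Implicit Types (P : set 'rV[R]_d) (p q v w x z : 'rV[R]_d).

Lemma sub_convex_hull (A : set 'rV[R]_d) : A `<=` convex_hull A.
Proof.
move=> x Ax; exists 1%N, (fun _ => 1), (fun _ => x).
by rewrite !big_ord_recl !big_ord0 !addr0 scale1r; split.
Qed.

Lemma polytope_has_lbound P v : polytope P -> has_lbound (pairing v @` P).
Proof.
move=> [A finA ->].
exists (- \sum_(a <- fset_set A) `|pairing v a|).
move=> _ [_ [n [a [p [Ap a0 a1 ->]]]] <-].
rewrite pairing_sumr -[leLHS]mul1r -a1 mulr_suml; apply: ler_sum => i _.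
rewrite pairingZr ler_wpM2l// lerNl.
have pA : p i \in fset_set A by rewrite in_fset_set// inE.
rewrite (bigD1_seq _ pA) ?fset_uniq//= -[leLHS]addr0 lerD ?sumr_ge0//.
by rewrite -normrN ler_norm.
Qed.

Lemma min_on_shift P v p z : polytope P -> P p ->
  min_on P (pairing v) = pairing v p ->
  min_on P (fun x => pairing v (x - z)) = pairing v p - pairing v z.
Proof.
move=> polyP Pp minp.
have lbP x : P x -> pairing v p <= pairing v x.
  move=> Px; rewrite -minp; apply: ge_inf; last by exists x.
  exact: polytope_has_lbound.
have lb : lbound [set pairing v (x - z) | x in P] (pairing v p - pairing v z).
  by move=> _ [x Px <-]; rewrite pairingBr lerD2r lbP.
apply/eqP; rewrite eq_le; apply/andP; split.
  apply: ge_inf; first by exists (pairing v p - pairing v z).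
  by exists p => //; rewrite pairingBr.
by apply: lb_le_inf => //; exists (pairing v (p - z)), p.
Qed.

(** The minimum is at most the value at the point of a small cube around [z]
    that lies opposite to the signs of [v]. *)
Lemma interior_min_on P z : polytope P -> P° z ->
  exists2 e, 0 < e & forall v,
    min_on P (fun x => pairing v (x - z)) <= - (e * \sum_i `|v 0 i|).
Proof.
move=> polyP /nbhs_ballP[e0 /= e00 Pe].
exists (e0 / 2); first by rewrite divr_gt0.
move=> v; pose x := z - (e0 / 2) *: (\row_i Num.sg (v 0 i)).
have Px : P x.
  apply: Pe; split=> // i j; rewrite /ball/= /x !mxE opprB addrC subrK.
  rewrite normrM (gtr0_norm (divr_gt0 e00 _))// normr_sg.
  by case: (v 0 j != 0); rewrite ?mulr1 ?mulr0// ltr_pdivrMr//; lra.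
have -> : - (e0 / 2 * \sum_i `|v 0 i|) = pairing v (x - z).
  rewrite /x addrC addKr -[in RHS]scaleNr pairingZr mulNr; congr (- (_ * _)).
  by apply: eq_bigr => i _; rewrite mxE normrEsg mulrC.
apply: ge_inf; last by exists x.
have [m lbm] := polytope_has_lbound v polyP.
exists (m - pairing v z) => _ [y Py <-].
by rewrite pairingBr lerD2r; apply: lbm; exists y.
Qed.

(** A form minimised only at [x] is minimal at every point that has a positive
    weight in a convex combination equal to [x]. *)
Lemma vertex_sub (A : set 'rV[R]_d) x : vertex (convex_hull A) x -> A x.
Proof.
move=> [v [p [Cp minp /seteqP[xp px]]]].
have [[n [a [q [Aq a0 a1 xE]]]] vx] := xp x erefl.
have /eqP : \sum_i a i * (pairing v (q i) - pairing v x) = 0.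
  under eq_bigr do rewrite mulrBr; rewrite sumrB -mulr_suml a1 mul1r.
  rewrite xE pairing_sumr; apply/eqP; rewrite subr_eq0; apply/eqP.
  by apply: eq_bigr => i _; rewrite pairingZr.
rewrite psumr_eq0 => [/allP/= aq|i _]; last first.
  by rewrite mulr_ge0// subr_ge0 vx minp//; exact: sub_convex_hull.
have [i ai] : exists i, a i != 0.
  apply: contrapT => /forallNP a00; have : (1 : R) = 0.
    by rewrite -a1 big1// => i _; apply/eqP/negPn/negP; exact: a00.
  by apply/eqP; rewrite oner_eq0.
have := aq i (mem_index_enum i).
rewrite mulf_eq0 (negbTE ai)/= subr_eq0 => /eqP vq.
suff <- : q i = x by [].
by apply: px; split; [exact: sub_convex_hull|rewrite vq vx].
Qed.

End Polytope.

Section Lattice.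
Variables (R : realType) (d : nat).
Implicit Types (P : set 'rV[R]_d) (p q v w x z : 'rV[R]_d).

Lemma latticeP v : lattice v <-> forall i, v 0 i \is a Num.int.
Proof.
split=> [[u _ <-] i|vi]; first by rewrite mxE.
exists (\row_i Num.floor (v 0 i)) => //; apply/rowP => i; rewrite !mxE.
exact: floorK.
Qed.

Lemma latticeD u v : lattice u -> lattice v -> lattice (u + v : 'rV[R]_d).
Proof.
by move=> /latticeP ui /latticeP vi; apply/latticeP => i; rewrite mxE rpredD.
Qed.

Lemma latticeB u v : lattice u -> lattice v -> lattice (u - v : 'rV[R]_d).
Proof.
by move=> /latticeP ui /latticeP vi; apply/latticeP => i; rewrite !mxE rpredB.
Qed.

Lemma latticeZ n v : lattice v -> lattice (n%:R *: v : 'rV[R]_d).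
Proof.
by move=> /latticeP vi; apply/latticeP => i; rewrite !mxE rpredM// rpred_nat.
Qed.

Lemma rational_clear_denominators x : rational_points x ->
  exists2 n, (0 < n)%N & lattice (n%:R *: x).
Proof.
move=> [u _ <-]; exists (\prod_i `|denq (u 0%R i)|)%N.
  by rewrite prodn_gt0// => i; rewrite absz_gt0 denq_eq0.
apply/latticeP => i; rewrite !mxE (bigD1 i)//= natrM mulrAC rpredM ?rpred_nat//.
have -> : `|denq (u 0%R i)|%N%:R * ratr (u 0 i) = (numq (u 0 i))%:~R :> R.
  rewrite natr_absz ger0_norm ?denq_ge0// mulrC.
  by rewrite -[RHS]ratr_int numqE rmorphM/= ratr_int.
exact: rpred_int.
Qed.

Lemma common_denominator (V : set 'rV[R]_d) : finite_set V ->
  (forall x, V x -> rational_points x) ->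
  exists2 n, (0 < n)%N & forall x, V x -> lattice (n%:R *: x).
Proof.
move=> finV ratV.
have /choice[n nP] x : exists n, (0 < n)%N /\ (V x -> lattice (n%:R *: x)).
  have [/ratV/rational_clear_denominators[n n0 nx]|nV] := pselect (V x).
    by exists n.
  by exists 1%N.
exists (\prod_(x <- fset_set V) n x)%N.
  by rewrite prodn_gt0// => x; case: (nP x).
move=> x Vx; have xV : x \in fset_set V by rewrite in_fset_set// inE.
rewrite (bigD1_seq _ xV) ?fset_uniq//= mulnC natrM -scalerA; apply: latticeZ.
by case: (nP x) => _; exact.
Qed.

Lemma rational_cone_lattice k (M : 'M[R]_(k, d)) :
  row_free M -> (forall i, rational_points (row i M)) ->
  exists M' : 'M[R]_(k, d),
    [/\ row_free M', forall i, lattice (row i M') & cone M = cone M'].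
Proof.
move=> fM ratM.
have /choice[n nP] i : exists n, (0 < n)%N /\ lattice (n%:R *: row i M).
  by have [n n0 nx] := rational_clear_denominators (ratM i); exists n.
pose D : 'rV[R]_k := \row_i (n i)%:R.
have n0 i : 0 < (n i)%:R :> R by rewrite ltr0n; case: (nP i).
exists (diag_mx D *m M).
have rowM i : row i (diag_mx D *m M) = (n i)%:R *: row i M.
  by rewrite row_mul row_diag_mx -scalemxAl -rowE mxE.
split.
- rewrite /row_free mxrankMfree// -/(row_free _) row_free_unit unitmxE det_diag.
  by rewrite unitfE; apply/prodf_neq0 => i _; rewrite mxE gt_eqF.
- by move=> i; rewrite rowM; case: (nP i).
apply/seteqP; split=> _ [a a0 ->].
  exists (\row_i (a 0 i / (n i)%:R)).
    by move=> i; rewrite mxE divr_ge0// ltW.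
  rewrite !mulmx_sum_row; apply: eq_bigr => i _; rewrite rowM mxE scalerA.
  by rewrite divfK// gt_eqF.
exists (\row_i (a 0 i * (n i)%:R)).
  by move=> i; rewrite mxE mulr_ge0// ltW.
by rewrite !mulmx_sum_row; apply: eq_bigr => i _; rewrite rowM mxE scalerA.
Qed.

End Lattice.



Section ConeVertex.
Variables (R : realType) (d : nat) (P : set 'rV[R]_d) (T : set (set 'rV[R]_d)).
Implicit Types (C : set 'rV[R]_d) (p v z : 'rV[R]_d).
Hypotheses (fanT : rational_simplicial_fan T) (completeT : complete T).
Hypothesis refT : refines T (normal_fan P).

(** On a face [F] whose dual cone contains a basis, all points pair equally with
    that basis, so [F] is a single point. *)
Lemma cone_vertex C : T C -> exists p, [/\ P p, vertex P p &
  forall v, C v -> min_on P (pairing v) = pairing v p].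
Proof.
move=> TC; have [M [fM TM CM]] := in_full_cone fanT completeT TC.
have [_ [F faceF ->] MF] := refT TM.
have [u [p [Pp minp FE]]] := faceF.
have Fp : F p by rewrite FE.
suff Funiq : F = [set p].
  exists p; split=> //; first by rewrite /vertex -Funiq.
  by move=> v /CM /MF; apply.
apply/seteqP; split=> [q Fq|_ ->//]; apply: trmx_inj.
suff : M *m q^T = M *m p^T.
  by move/(congr1 (mulmx (invmx M))); rewrite !mulKmx// -row_free_unit.
apply/matrixP => i j; rewrite (ord1 j).
have rowE (x : 'rV[R]_d) : (M *m x^T) i 0 = pairing (row i M) x.
  by rewrite pairing_mx -row_mul [RHS]mxE.
have minF := MF _ (cone_row M i).
by rewrite !rowE -(minF _ Fq) -(minF _ Fp).
Qed.

End ConeVertex.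

(** * Rational functions of the exponentials *)
Section RationalFunctions.
Variables (R : realType) (d : nat) (P : set 'rV[R]_d) (N : nat).
Implicit Types (f g : R -> 'rV[R]_d -> R).

Local Notation wpoint y0 z := (Defs.point (y0 `^ N%:R^-1) (exp_ y0 z)).

Lemma eq_rational f g : rational_function P N f ->
  (forall y0 z, 1 < y0 -> P° z -> g y0 z = f y0 z) -> rational_function P N g.
Proof.
move=> [num [den H]] gf; exists num, den => y0 z y1 Pz w.
by have [d0 fE] := H y0 z y1 Pz; rewrite gf.
Qed.

Lemma rational_cst c : rational_function P N (fun _ _ => c).
Proof.
exists (mpoly.mpolyC d.+1 c), 1 => y0 z _ _ w.
by rewrite mpoly.mevalC rmorph1 oner_neq0 divr1.
Qed.

Lemma rational_coord i :
  rational_function P N (fun y0 z => wpoint y0 z i).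
Proof.
exists (mpoly.mpolyX R (mpoly.mnm1 i)), 1 => y0 z _ _ w.
by rewrite mpoly.mevalXU rmorph1 oner_neq0 divr1.
Qed.

Lemma rational_add f g : rational_function P N f -> rational_function P N g ->
  rational_function P N (fun y0 z => f y0 z + g y0 z).
Proof.
move=> [n1 [d1 H1]] [n2 [d2 H2]]; exists (n1 * d2 + n2 * d1), (d1 * d2).
move=> y0 z y1 Pz w.
have [e1 ->] := H1 y0 z y1 Pz; have [e2 ->] := H2 y0 z y1 Pz.
rewrite rmorphD !rmorphM/= mulf_neq0//; split=> //.
by rewrite addf_div.
Qed.

Lemma rational_mul f g : rational_function P N f -> rational_function P N g ->
  rational_function P N (fun y0 z => f y0 z * g y0 z).
Proof.
move=> [n1 [d1 H1]] [n2 [d2 H2]]; exists (n1 * n2), (d1 * d2).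
move=> y0 z y1 Pz w.
have [e1 ->] := H1 y0 z y1 Pz; have [e2 ->] := H2 y0 z y1 Pz.
by rewrite !rmorphM/= mulf_neq0//; split=> //; rewrite mulf_div.
Qed.

Lemma rational_inv f : rational_function P N f ->
  (forall y0 z, 1 < y0 -> P° z -> f y0 z != 0) ->
  rational_function P N (fun y0 z => (f y0 z)^-1).
Proof.
move=> [n [e H]] f0; exists e, n => y0 z y1 Pz w.
have := f0 y0 z y1 Pz; have [e0 ->] := H y0 z y1 Pz.
by rewrite mulf_eq0 negb_or invf_div => /andP[].
Qed.

Lemma rational_sum (I : eqType) (s : seq I) (F : I -> R -> 'rV[R]_d -> R) :
  (forall i, i \in s -> rational_function P N (F i)) ->
  rational_function P N (fun y0 z => \sum_(i <- s) F i y0 z).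
Proof.
elim: s => [|i s IHs] FR.
  by apply: eq_rational (rational_cst 0) _ => *; rewrite big_nil.
have Fi := FR i (mem_head i s).
have {}IHs := IHs (fun j js => FR j (mem_behead (s := i :: s) js)).
by apply: eq_rational (rational_add Fi IHs) _ => *; rewrite big_cons.
Qed.

Lemma rational_prod (I : Type) (s : seq I) (F : I -> R -> 'rV[R]_d -> R) :
  (forall i, rational_function P N (F i)) ->
  rational_function P N (fun y0 z => \prod_(i <- s) F i y0 z).
Proof.
move=> FR; elim: s => [|i s IHs].
  by apply: eq_rational (rational_cst 1) _ => *; rewrite big_nil.
by apply: eq_rational (rational_mul (FR i) IHs) _ => *; rewrite big_cons.
Qed.

Lemma point_gt0 y0 (z : 'rV[R]_d) i : 1 < y0 -> 0 < wpoint y0 z i.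
Proof.
move=> y1; rewrite /Defs.point; case: unlift => [j|]; rewrite ?mxE.
  by rewrite powR_gt0// (lt_trans ltr01).
by rewrite powR_gt0// (lt_trans ltr01).
Qed.

Lemma rational_coord_exprz i (n : int) :
  rational_function P N (fun y0 z => wpoint y0 z i ^ n).
Proof.
have X m : rational_function P N (fun y0 z => wpoint y0 z i ^+ m).
  elim: m => [|m IHm].
    by apply: eq_rational (rational_cst 1) _ => *; rewrite expr0.
  apply: eq_rational (rational_mul (rational_coord i) IHm) _ => *.
  by rewrite exprS.
case: n => m; first exact: X.
apply: eq_rational (rational_inv (X m.+1) _) _ => // y0 z y1 Pz.
by rewrite expf_neq0// gt_eqF// point_gt0.
Qed.

Lemma powR_sum (y : R) (I : finType) (a : I -> R) : 0 < y ->
  \prod_i y `^ a i = y `^ \sum_i a i.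
Proof.
move=> y0; apply/esym.
apply: (big_morph (fun x => y `^ x)) => [x x'|]; last exact: powRr0.
by rewrite powRD // (gt_eqF y0) implybT.
Qed.

Lemma powR_exprz (y x : R) (n : int) : (y `^ x) ^ n = y `^ (x * n%:~R).
Proof. by rewrite powRrM powR_intmul// powR_ge0. Qed.

(** The exponent v(p) is an integer multiple of 1/N because N p is a lattice
    point, and the coordinates of [v] are integers: a Laurent monomial. *)
Lemma rational_character (v p : 'rV[R]_d) : (0 < N)%N ->
  lattice v -> lattice (N%:R *: p) ->
  rational_function P N (fun y0 z => y0 `^ (pairing v p - pairing v z)).
Proof.
move=> N0 [u _ uv] [r _ rp].
(* Exponents of y0^(1/N), at index 0, and of the y_j. *)
pose e (i : 'I_d.+1) : int :=
  if unlift ord0 i is Some j then - u 0 j else \sum_j u 0 j * r 0 j.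
apply: eq_rational
  (rational_prod (index_enum _) (fun i => rational_coord_exprz i (e i))) _.
move=> y0 z y1 _; have y00 : 0 < y0 by exact: lt_trans y1.
rewrite big_ord_recl/= /Defs.point /e unlift_none.
under eq_bigr do rewrite liftK mxE powR_exprz//.
rewrite powR_sum// powR_exprz// -powRD; last by rewrite (gt_eqF y00) implybT.
apply: (congr1 (powR y0)); congr (_ + _).
  rewrite rmorph_sum/= mulr_sumr; apply: eq_bigr => i _.
  have /rowP/(_ i) := rp; rewrite !mxE => rpi.
  rewrite rmorphM/= rpi -uv mxE; field.
  by rewrite pnatr_eq0 -lt0n.
rewrite -sumrN; apply: eq_bigr => i _.
by rewrite -uv mxE mulrNz mulrN mulrC.
Qed.

End RationalFunctions.


(** * Lattice sums over a simplicial cone *)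
Lemma finite_bounded_lattice (R : realType) d (S : set 'rV[R]_d) (B : R) :
  (forall v, S v -> lattice v /\ forall i, `|v 0 i| <= B) -> finite_set S.
Proof.
move=> SB.
pose n := Num.bound B.
pose dec (g : {ffun 'I_d -> bool * 'I_n.+1}) : 'rV[R]_d :=
  \row_i ((-1) ^+ (g i).1 * (g i).2%:R).
apply: (@sub_finite_set _ _ (dec @` setT)); last exact: finite_image.
move=> v /SB[/latticeP vZ vB].
exists [ffun i => (v 0 i < 0, inord `|Num.floor (v 0%R i)|%N)] => //.
apply/rowP => i; rewrite !mxE ffunE/=.
have fl : (Num.floor (v 0 i))%:~R = v 0 i by exact: floorK.
have B0 : 0 <= B by apply: le_trans (vB i).
rewrite inordK.
  by rewrite natr_absz intr_norm fl -realEsign ?num_real.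
rewrite ltnS -(ler_nat R) natr_absz intr_norm fl (le_trans (vB i))// ltW//.
by apply: archi_boundP.
Qed.

Section Slabs.
Variables (R : realType) (d k : nat) (M : 'M[R]_(k, d)).
Hypotheses (freeM : row_free M) (latM : forall i, lattice (row i M)).

(** These sets interpolate between all lattice points of the cone, for [j = 0],
    and those of the half-open fundamental parallelepiped, for [j = k]. *)
Definition slab (j : nat) : set 'rV[R]_d :=
  [set v | lattice v /\ exists2 a : 'rV[R]_k,
    forall i, 0 <= a 0 i /\ ((i < j)%N -> a 0 i < 1) & v = a *m M].

Lemma slab0 : slab 0 = cone M `&` @lattice R d.
Proof.
apply/seteqP; split=> v.
  by move=> [Lv [a a0 va]]; split=> //; exists a => // i; case: (a0 i).
by move=> [[a a0 va] Lv]; split=> //; exists a.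
Qed.

Lemma slab_finite : finite_set (slab k).
Proof.
apply: (@finite_bounded_lattice _ _ _ (\sum_i \sum_j `|M i j|)).
move=> v [Lv [a a01 va]].
split=> // j; rewrite va mxE (le_trans (ler_norm_sum _ _ _))//.
apply: ler_sum => i _; rewrite normrM.
have [a0 /(_ (ltn_ord i)) a1] := a01 i.
rewrite (ger0_norm a0) (@le_trans _ _ `|M i j|)//.
  by rewrite ler_piMl// ltW.
by rewrite (bigD1 j)//= lerDl sumr_ge0.
Qed.

Lemma slab_sub j : slab j.+1 `<=` slab j.
Proof.
move=> v [Lv [a a01 va]]; split=> //; exists a => // i; have [a0 a1] := a01 i.
by split=> // ij; apply: a1; exact: ltnW.
Qed.

(** A lattice point whose coordinate [j] is at least 1 stays in the cone after
    subtraction of the lattice vector [row j M]. *)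
Lemma slab_shift (j : 'I_k) :
  slab j `&` ~` slab j.+1 = (fun v => v + row j M) @` slab j.
Proof.
apply/seteqP; split=> v.
  move=> [[Lv [a a01 va]] nv].
  have aj : 1 <= a 0 j.
    rewrite leNgt; apply/negP => aj; apply: nv; split=> //; exists a => // i.
    have [a0 a1] := a01 i; split=> //; rewrite ltnS leq_eqVlt => /orP[|//].
    by move=> /eqP/val_inj ->.
  exists (v - row j M); last by rewrite subrK.
  split; first exact: latticeB.
  exists (a - delta_mx 0 j); last by rewrite mulmxBl -rowE va.
  move=> i; rewrite !mxE eqxx/=; have [a0 a1] := a01 i.
  have [->|ij] := eqVneq i j; first by rewrite subr_ge0 ltnn.
  by rewrite subr0.
move=> [u [Lu [b b01 ub]] <-].
have E : u + row j M = (b + delta_mx 0 j) *m M by rewrite mulmxDl -rowE ub.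
have bE i : (b + delta_mx 0 j) 0 i = b 0 i + (i == j)%:R by rewrite !mxE eqxx.
split.
  split; first exact: latticeD.
  exists (b + delta_mx 0 j) => // i; rewrite bE; have [b0 b1] := b01 i.
  split; first by rewrite addr_ge0.
  by have [->|ij] := eqVneq i j; rewrite ?ltnn// addr0.
move=> [_ [a a01]]; rewrite E => /(congr1 (mulmxr (pinvmx M)))/=.
rewrite !coordK// => /rowP/(_ j); rewrite bE eqxx => abj.
have [_ /(_ (ltnSn j))] := a01 j; have [b0 _] := b01 j.
by rewrite -abj ltNge lerDr b0.
Qed.

Variable chi : 'rV[R]_d -> R.
Hypotheses (chi0 : forall v, 0 <= chi v)
  (chiD : forall u v, chi (u + v) = chi u * chi v)
  (sum_chi : (\esum_(v in slab 0) (chi v)%:E < +oo)%E).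

Local Notation S j := (\esum_(v in slab j) (chi v)%:E)%E.

Lemma slab_sum_fin j : S j \is a fin_num.
Proof.
have slabE : slab j = slab j `&` slab 0.
  rewrite setIidl//; elim: j => // j IHj.
  exact: subset_trans (@slab_sub j) IHj.
by rewrite slabE; exact: esum_sub_fin.
Qed.

(** The points removed at step [j] form a translate of the whole set, and a
    translation multiplies the sum of a character by a constant: this is the
    summation of a geometric series in the form that needs no division. *)
Lemma slab_sum_step (j : 'I_k) :
  fine (S j.+1) = fine (S j) * (1 - chi (row j M)).
Proof.
have : (S j = S j.+1 + (chi (row j M))%:E * S j)%E.
  rewrite [LHS](esumID (slab j.+1)); last by move=> *; rewrite lee_fin.
  rewrite (setIidr (@slab_sub j)) slab_shift esum_image; last first.
    by move=> u v _ _; exact: addIr.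
  rewrite -esum_pZl//; congr (_ + _)%E; apply: eq_esum => v _.
  by rewrite chiD -EFinM mulrC.
have f1 := slab_sum_fin j.+1; have f0 := slab_sum_fin j.
rewrite -(fineK f0) -(fineK f1) -EFinM -EFinD => -[].
by move=> /eqP; rewrite -subr_eq => /eqP <-; rewrite mulrBr mulr1 mulrC.
Qed.

Lemma slab_sum_prod : fine (S k) = fine (S 0) * \prod_i (1 - chi (row i M)).
Proof.
suff H j : (j <= k)%N ->
    fine (S j) = fine (S 0) * \prod_(i < k | (i < j)%N) (1 - chi (row i M)).
  by rewrite H//; congr (_ * _); apply: eq_bigl => i; rewrite ltn_ord.
elim: j => [|j IHj] jk; first by rewrite big_pred0 ?mulr1// => i; rewrite ltn0.
rewrite (slab_sum_step (Ordinal jk)) IHj 1?ltnW//.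
rewrite [in RHS](bigD1 (Ordinal jk))//= -mulrA [_ * (1 - _)]mulrC.
congr (_ * (_ * _)); apply: eq_bigl => i.
by rewrite -val_eqE/= ltnS ltn_neqAle andbC.
Qed.

End Slabs.


(** * The dual lattice function *)
Lemma powR_lt1 (R : realType) (y x : R) : 1 < y -> x < 0 -> y `^ x < 1.
Proof.
move=> y1 x0; rewrite lt_neqAle -{2}(powRr0 y) ler_powR ?ltW// andbT powR_eq1.
by rewrite !negb_or gt_eqF// -leNgt (ltW (lt_trans ltr01 y1)) lt_eqF.
Qed.

Section DualLatticeFunction.
Variables (R : realType) (d : nat) (P : set 'rV[R]_d) (T : set (set 'rV[R]_d)).
Implicit Types (C : set 'rV[R]_d) (p v z : 'rV[R]_d).
Hypotheses (polyP : polytope P) (fanT : rational_simplicial_fan T).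
Hypotheses (completeT : complete T) (refT : refines T (normal_fan P)).

Lemma K_term_ge0 y0 z v : 0 <= K_term P y0 z v.
Proof. exact: powR_ge0. Qed.

Lemma K_term_sum_lty y0 z : 1 < y0 -> P° z ->
  (\esum_(v in @lattice R d) (K_term P y0 z v)%:E < +oo)%E.
Proof.
move=> y1 Pz; have [e e0 minP] := interior_min_on polyP Pz.
have y00 : 0 < y0 by exact: lt_trans y1.
have q01 : 0 <= y0 `^ (- e) < 1.
  by rewrite powR_ge0 powR_lt1// oppr_lt0.
apply: le_lt_trans (lattice_geometric_lty d q01).
apply: le_esum => v _; rewrite lee_fin -powRrM mulNr.
by apply: ler_powR; [exact: ltW|exact: minP].
Qed.

Lemma K_cone_cover (c : set 'rV[R]_d -> R)
    (A : set 'rV[R]_d -> set 'rV[R]_d) y0 z :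
  1 < y0 -> P° z ->
  (forall v, \sum_(C <- fset_set T) c C * (v \in A C)%:R = 1) ->
  K P y0 z = \sum_(C \in T) c C * K_sum P (A C) y0 z.
Proof.
move=> y1 Pz cover; have finT : finite_set T by case: fanT.
rewrite /K /K_sum setTI fsbig_finite//.
apply: (fine_esum_cover (A := A)) => //; first exact: K_term_ge0.
exact: K_term_sum_lty.
Qed.

(** The smallest cone that contains [v] is the one with [v] in its relative
    interior.  The coefficients 1 give the sum the form that [K_cone_cover]
    expects. *)
Lemma relative_interior_cover v :
  \sum_(C <- fset_set T) 1 * (v \in relative_interior C)%:R = 1 :> R.
Proof.
have relE C : T C -> relative_interior C = core C.
  by move=> /(fan_cone fanT)[k [M [fM ->]]]; exact: relative_interior_cone.
have [C TC Cv] : exists2 C, T C & C v.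
  by have : [set: 'rV[R]_d] v by []; rewrite -completeT => -[C]; exists C.
have [D TD Dv] := face_core fanT TC Cv.
under eq_bigr do rewrite mul1r.
apply: (@sum_unique _ _ _ (fun C => v \in relative_interior C) D).
- exact: fset_uniq.
- exact/(in_fanP fanT).
- by rewrite inE relE.
move=> E /(in_fanP fanT) TE; rewrite inE relE// => Ev.
exact: (core_inj fanT TE TD Ev Dv).
Qed.

(** For [m] a nonzero lattice point of [C] the character is less than 1, as the
    exponent is the minimum of a nonzero form on [P - z], a neighbourhood of 0;
    so none of the factors 1 - chi(m) in the denominator vanishes. *)
Lemma rational_K_cone N C : denominator P N -> T C ->
  rational_function P N (K_cone P C).
Proof.
move=> [N0 latP] TC.
have [p [Pp vertp minp]] := cone_vertex fanT completeT refT TC.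
have Np := latP _ vertp.
have [k [M [fM latM CM]]] : exists k (M : 'M[R]_(k, d)),
    [/\ row_free M, forall i, lattice (row i M) & C = cone M].
  case: fanT => _ /(_ C TC) [k [M [fM ratM CE]]] _ _.
  have [M' [fM' latM' MM']] := rational_cone_lattice fM ratM.
  by exists k, M'; split=> //; rewrite -MM'.
pose chi y0 z v : R := y0 `^ (pairing v p - pairing v z).
have K_termE y0 z v : C v -> K_term P y0 z v = chi y0 z v.
  by move=> Cv; rewrite /K_term (min_on_shift _ polyP Pp (minp v Cv)).
have chi_lt1 y0 z i : 1 < y0 -> P° z -> chi y0 z (row i M) < 1.
  move=> y1 Pz; have [e e0 minP] := interior_min_on polyP Pz.
  have Ci : C (row i M) by rewrite CM; exact: cone_row.
  rewrite /chi -(min_on_shift z polyP Pp (minp _ Ci)) powR_lt1//.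
  rewrite (le_lt_trans (minP _))// oppr_lt0 mulr_gt0//.
  rewrite lt_neqAle sumr_ge0// andbT eq_sym psumr_eq0//.
  apply/negP => /allP/= row0; suff Mi0 : row i M = 0.
    have := coordK fM (delta_mx 0 i); rewrite -rowE Mi0 mul0mx.
    by move=> /rowP/(_ i)/eqP; rewrite !mxE !eqxx eq_sym oner_eq0.
  apply/rowP => j; rewrite [RHS]mxE; apply/normr0_eq0/eqP.
  exact: row0 (mem_index_enum j).
have chi_char v : lattice v -> rational_function P N (fun y0 z => chi y0 z v).
  by move=> Lv; exact: rational_character.
have finS := slab_finite M.
apply: (@eq_rational _ _ _ _ (fun y0 z =>
  (\sum_(v <- fset_set (slab M k)) chi y0 z v) *
  (\prod_(i < k) (1 - chi y0 z (row i M)))^-1)).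
  apply: rational_mul.
    apply: rational_sum => v; rewrite in_fset_set// inE => -[Lv _].
    exact: chi_char.
  apply: rational_inv => [|y0 z y1 Pz].
    apply: rational_prod => i; apply: rational_add; first exact: rational_cst.
    have chiN := rational_mul (rational_cst P N (-1)) (chi_char _ (latM i)).
    apply: eq_rational chiN _.
    by move=> *; rewrite mulN1r.
  by apply/prodf_neq0 => i _; rewrite gt_eqF// subr_gt0 chi_lt1.
move=> y0 z y1 Pz.
have y00 : 0 < y0 by exact: lt_trans y1.
have E0 : (\esum_(v in C `&` @lattice R d) (K_term P y0 z v)%:E =
           \esum_(v in slab M 0) (chi y0 z v)%:E)%E.
  by rewrite slab0 -CM; apply: eq_esum => v [Cv _]; rewrite K_termE.
have chi0 v : 0 <= chi y0 z v by exact: powR_ge0.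
have chiD u v : chi y0 z (u + v) = chi y0 z u * chi y0 z v.
  rewrite /chi !pairingDl -powRD; last by rewrite (gt_eqF y00) implybT.
  by apply: (congr1 (powR y0)); ring.
have S0 : (\esum_(v in slab M 0) (chi y0 z v)%:E < +oo)%E.
  rewrite -E0; apply: le_lt_trans (K_term_sum_lty y1 Pz).
  rewrite esum_mkcondl; apply: le_esum => v _.
  by case: ifP => // _; rewrite lee_fin K_term_ge0.
have := slab_sum_prod fM latM chi0 chiD S0.
rewrite [in LHS]esum_fset//; last by move=> v _; rewrite lee_fin.
rewrite fsbig_finite// sumEFin/= => ->.
rewrite mulfK; first by rewrite /K_cone /K_sum E0.
by apply/prodf_neq0 => i _; rewrite gt_eqF// subr_gt0 chi_lt1.
Qed.

Lemma rational_K N : denominator P N -> rational_function P N (K P).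
Proof.
move=> denN; have finT : finite_set T by case: fanT.
apply: (@eq_rational _ _ _ _ (fun y0 z =>
  \sum_(C <- fset_set T) (-1) ^+ codim C * K_cone P C y0 z)).
  apply: rational_sum => C /(in_fanP fanT) TC.
  by apply: rational_mul; [exact: rational_cst|exact: rational_K_cone].
move=> y0 z y1 Pz; rewrite -fsbig_finite//.
exact: K_cone_cover (fan_euler fanT completeT).
Qed.

End DualLatticeFunction.

(** The vertices are among the finitely many points that span the polytope. *)
Lemma denominator_ex (R : realType) d (P : set 'rV[R]_d) :
  rational_polytope P -> exists N, denominator P N.
Proof.
move=> [[A finA ->] ratP].
have [|N N0 NP] := @common_denominator _ _ (vertex (convex_hull A)) _ ratP.
  by apply: sub_finite_set finA => x; exact: vertex_sub.
by exists N.
Qed.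

Theorem theorem3p7 (R : realType) (d : nat) (P : set 'rV[R]_d)
    (T : set (set 'rV[R]_d)) :
  rational_polytope P -> full_dimensional P ->
  rational_simplicial_fan T -> complete T -> refines T (normal_fan P) ->
  [/\ forall (y0 : R) (z : 'rV[R]_d), 1 < y0 -> P° z ->
        [/\ summable (@lattice R d) (fun v => (K_term P y0 z v)%:E),
            K P y0 z = \sum_(C \in T) (-1) ^+ codim C * K_cone P C y0 z
          & K P y0 z = \sum_(C \in T) K_cone_int P C y0 z],
      exists N : nat, denominator P N
    & forall N : nat, denominator P N -> rational_function P N (K P)].
Proof.
move=> ratP _ fanT completeT refT; have [polyP _] := ratP.
split; [move=> y0 z y1 Pz; split| |].
- rewrite /summable; under eq_esum do rewrite gee0_abs ?lee_fin ?K_term_ge0//.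
  exact: K_term_sum_lty.
- exact: K_cone_cover (fan_euler fanT completeT).
- rewrite (K_cone_cover polyP fanT y1 Pz
    (relative_interior_cover fanT completeT)).
  by apply: eq_fsbigr => C _; rewrite mul1r.
- exact: denominator_ex.
- by move=> N; exact: (rational_K polyP fanT completeT refT).
Qed.
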